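(* Let $p\neq 2$ be a prime, let $n,k,l$ be positive integers with $l\mid k$ and $\frac{k}{l}$ even, put $d=\gcd(n,k)$, $e=\gcd(n,l)$, $L=\operatorname{lcm}(d,l)$, and let $a\in\mathbb{F}_{p^n}$. Let $\delta\in \mathbb{F}_{p^n}^*$ be any element such that $T_d^n(\delta)=1$. 1. When $\frac{d}{e}$ is odd, or when $\frac{d}{e}$ is even and $p\mid\frac{k}{L}$, there exists a solution in $\mathbb{F}_{p^n}$ to the equation $S_l^k(X)=a$ if and only if $T_d^n(a)=0$. In that case, $$x_0=T_l^{2l}\Bigl(\sum_{i=0}^{\frac{n}{d}-2}\sum_{j=i+1}^{\frac{n}{d}-1}\delta^{p^{kj}}a^{p^{ki}}\Bigr)$$ is a particular $\mathbb{F}_{p^n}$-solution to the equation $S_l^k(X)=a$. 2. When $\frac{d}{e}$ is even and $p\nmid\frac{k}{L}$, there exists a solution in $\mathbb{F}_{p^n}$ to the equation $S_l^k(X)=a$ if and only if $T_e^{2e}\circ T_d^n(a)=0$. In that case, for any $\delta_1\in\mathbb{F}_{p^d}^*$ such that $T_{2e}^d(\delta_1)=1$, $$x_0=y_0+\frac{L}{2k}\bigl(a-S_l^k(y_0)\bigr)\delta_1,\qquad\text{where}\qquad y_0=\sum_{i=0}^{\frac{n}{d}-2}\sum_{j=i+1}^{\frac{n}{d}-1}\delta^{p^{kj}}\bigl(T_l^{2l}(a)\bigr)^{p^{ki}},$$ is a particular $\mathbb{F}_{p^n}$-solution to the equation $S_l^k(X)=a$.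
   Context: For positive integers $u\mid v$ and a prime $p$, define the linearized polynomials $T_u^v(X)=\sum_{i=0}^{v/u-1}X^{p^{ui}}$ and $S_u^v(X)=\sum_{i=0}^{v/u-1}(-1)^iX^{p^{ui}}$; in particular $T_u^{2u}(X)=X+X^{p^u}$. All finite fields $\mathbb{F}_{p^m}$ are regarded as subfields of a fixed algebraic closure $\overline{\mathbb{F}_p}$. Since $d\mid k$ and $l\mid k$, $L$ divides $k$, and $e\mid d$. When $p\nmid \frac{k}{L}$ (and $p\ne2$), $\frac{L}{2k}$ denotes the inverse in $\mathbb{F}_p$ of the integer $\frac{2k}{L}$ reduced mod $p$. Empty sums are $0$. *)

(* Defs.v *)
From HB Require Import structures.
From mathcomp Require Export all_boot all_order all_algebra.
From mathcomp Require Import separable.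

Set Implicit Arguments.
Unset Strict Implicit.
Unset Printing Implicit Defensive.

Import GRing.Theory.
Local Open Scope ring_scope.

(* F_(p^m) inside a field K, meant for K algebraically closed of
   characteristic p and 0 < m: there it is the unique subfield of K with p^m
   elements; see GF_divring_closed, GF_card and GF_unique below. *)
Definition GF (p : nat) (K : closedFieldType) (m : nat) : {pred K} :=
  [pred x | x ^+ (p ^ m) == x].

(* The linearized polynomials T_u^v and S_u^v, meant for u %| v. *)
Definition Tpoly (p : nat) (K : closedFieldType) (u v : nat) : {poly K} :=
  \sum_(0 <= i < v %/ u) 'X^(p ^ (u * i)).

Definition Spoly (p : nat) (K : closedFieldType) (u v : nat) : {poly K} :=
  \sum_(0 <= i < v %/ u) (-1) ^+ i *: 'X^(p ^ (u * i)).

Arguments GF p K m : clear implicits.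
Arguments Tpoly p {K} u v.
Arguments Spoly p {K} u v.

Section GFFacts.

Variables (p : nat) (K : closedFieldType) (m : nat).
Hypothesis pcharK : p \in [pchar K].

Lemma GF_divring_closed : divring_closed (GF p K m).
Proof.
have pn : [pchar K].-nat (p ^ m)%N.
  by rewrite pnatX (eq_pnat _ (pcharf_eq pcharK)) pnat_id ?(pcharf_prime pcharK).
split=> [|x y /eqP xF /eqP yF|x y /eqP xF /eqP yF]; rewrite !inE.
- by rewrite expr1n.
- by rewrite exprDn_pchar // exprNn_pchar // xF yF.
- by rewrite expr_div_n xF yF.
Qed.

Hypothesis m_gt0 : (0 < m)%N.

Lemma GF_card : exists s : seq K, [/\ uniq s, size s = (p ^ m)%N & s =i GF p K m].
Proof.
have p_gt1 := prime_gt1 (pcharf_prime pcharK).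
have q_gt1 : (1 < p ^ m)%N by rewrite -(exp1n m) ltn_exp2r.
pose q : {poly K} := 'X^(p ^ m) - 'X.
have szq : size q = (p ^ m).+1 by rewrite size_polyDl size_polyXn // size_polyN size_polyX.
have lcq : lead_coef q = 1.
  by rewrite lead_coefDl ?lead_coefXn // size_polyN size_polyX size_polyXn.
have [s Dq] := closed_field_poly_normal q.
rewrite lcq scale1r in Dq; exists s; split.
- have qr0 : (p ^ m)%:R = 0 :> K.
    by rewrite natrX (pcharf0 pcharK) expr0n eqn0Ngt m_gt0.
  rewrite -separable_prod_XsubC -Dq unlock derivB derivXn derivX.
  rewrite -scaler_nat qr0 scale0r sub0r -scaleN1r.
  by rewrite coprimepZr ?oppr_eq0 ?oner_eq0 // coprimep1.
- by apply: succn_inj; rewrite -(size_prod_XsubC s id) -Dq.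
- by move=> x; rewrite -root_prod_XsubC -Dq rootE !hornerE subr_eq0.
Qed.

Lemma GF_unique (s : seq K) :
  uniq s -> size s = (p ^ m)%N -> divring_closed [in s] -> s =i GF p K m.
Proof.
move=> Us szs [s1 sB sdiv].
have s0 : 0 \in s by rewrite -(subrr 1) sB.
have sub : {subset s <= GF p K m}.
  move=> x sx; rewrite inE; have [->|nz_x] := eqVneq x 0.
    by rewrite expr0n expn_eq0 -leqn0 leqNgt (prime_gt0 (pcharf_prime pcharK)).
  have Ut : uniq (rem 0 s) by apply: rem_uniq.
  have sM y : y \in s -> x * y \in s.
    move=> sy; rewrite -[y]invrK; apply: (sdiv) => //.
    by rewrite -[y^-1]mul1r; apply: (sdiv).
  have Pt : perm_eq [seq x * y | y <- rem 0 s] (rem 0 s).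
    apply: uniq_perm => //.
      by rewrite map_inj_uniq //; apply: mulfI.
    have Uxt : uniq [seq x * y | y <- rem 0 s].
      by rewrite map_inj_uniq //; apply: mulfI.
    have [] // := uniq_min_size Uxt (s2 := rem 0 s); last by rewrite size_map.
    move=> _ /mapP[y + ->]; rewrite !(mem_rem_uniq _ Us) !inE => /andP[nz_y sy].
    by rewrite mulf_neq0 //= sM.
  have := perm_big (rem 0 s) Pt (op := *%R) (x := 1) (P := predT) (F := id).
  rewrite big_map big_split big_const_seq iter_mulr_1 count_predT /= size_rem // szs.
  set P := \prod_(i <- _) _; have nzP : P != 0.
    rewrite prodf_seq_neq0; apply/allP => y.
    by rewrite (mem_rem_uniq _ Us) inE => /andP[].
  rewrite -[X in _ = X]mul1r => /(mulIf nzP) xq1.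
  rewrite -(prednK (_ : 0 < p ^ m)%N) ?exprS ?xq1 ?mulr1 //.
  by rewrite expn_gt0 (prime_gt0 (pcharf_prime pcharK)).
have [t [Ut szt Dt]] := GF_card.
have sub' : {subset s <= t} by move=> x /sub; rewrite Dt.
have [_ st] := uniq_min_size Us sub' (eq_leq (etrans szt (esym szs))).
by move=> x; rewrite st Dt.
Qed.

End GFFacts.

(* Main.v *)
(* Write F for the Frobenius x |-> x^p, acting on F_(p^n) with order n. Since
   k/l is even, (1 + F^l) S_l^k = 1 - F^k, and on F_(p^n) the sum of the n/d
   powers of F^k is T_d^n because F^k and F^d generate the same group. Additive
   Hilbert 90 for F^k therefore solves (1 - F^k) y = b when T_d^n(b) = 0, and
   (1 + F^l) y is a solution of S_l^k = b.
   Conversely T_d^n(S_l^k(x)) = S_l^k(z) with z = T_d^n(x) in F_(p^d), where F^l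
   has order r = d/e. There S_l^k(z) is negated by F^l: it vanishes if r is odd
   (apply F^(lr) = 1), and it is k/L times an alternating sum of r terms if r is
   even. When r is even, Hilbert 90 applied to (1 + F^l)(a) gives y0 such that
   u = a - S_l^k(y0) is negated by F^l; then S_l^k(u delta1) is u times the
   (k/l)-term trace of delta1, which is 2k/L, so y0 + (L/2k) u delta1 is a
   solution. *)
Require Import Defs.
From HB Require Import structures.
From mathcomp Require Import all_boot all_order all_algebra zify.

Set Implicit Arguments.
Unset Strict Implicit.
Unset Printing Implicit Defensive.

Import GRing.Theory.
Local Open Scope ring_scope.

(** * Telescoping form of additive Hilbert 90 *)

(* Here [D i] and [A i] are the i-th conjugates of delta and a. *)
Lemma additive_hilbert90 (R : comPzRingType) (D A : nat -> R) (n : nat) :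
    (0 < n)%N -> D n = D 0%N ->
    \sum_(0 <= i < n) D i = 1 -> \sum_(0 <= i < n) A i = 0 ->
  \sum_(0 <= i < n.-1) \sum_(i.+1 <= j < n) D j * A i
    - \sum_(0 <= i < n.-1) \sum_(i.+1 <= j < n) D j.+1 * A i.+1 = A 0%N.
Proof.
case: n => // m _ Dm; rewrite !big_nat_recl //= => sumD sumA.
(* [G i] is a tail of the sum of [D]. Shifting its indices gives [G i.+1 + D 0], because [D] wraps
   around at [n]. The difference then telescopes to G 0 A 0 - D 0 (A 1 + ... + A m), which is (1 - D
   0) A 0 + D 0 A 0. *)
pose G i := \sum_(i.+1 <= j < m.+1) D j.
have G0 : G 0%N = 1 - D 0%N by rewrite -sumD /G big_add1 /= addrC addKr.
have Gm : G m = 0 by rewrite /G big_geq.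
have GS i : (i < m)%N -> \sum_(i.+1 <= j < m.+1) D j.+1 = G i.+1 + D 0%N.
  by move=> lt_im; rewrite -Dm -(big_add1 _ _ i.+1 m.+2 xpredT) big_nat_recr.
under eq_bigr => i _ do rewrite -big_distrl -/(G i) /=.
under [X in _ - X]eq_big_nat => i /andP[_ lt_im] do
  rewrite -big_distrl /= GS // mulrDl.
have: \sum_(0 <= i < m.+1) G i * A i = \sum_(0 <= i < m) G i * A i.
  by rewrite big_nat_recr //= Gm mul0r addr0.
rewrite big_nat_recl //= => <-; rewrite big_split -big_distrr /= opprD addrA addrK.
by rewrite G0 -(addr0_eq sumA) mulrBl mul1r mulrN opprK subrK.
Qed.

(** Carrying [charK] as an argument allows [frob charK j] to be declared a ring morphism for every
    [j]. *)
Definition frob (K : closedFieldType) (p : nat) (charK : p \in [pchar K])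
  (j : nat) (x : K) : K := x ^+ (p ^ j).

Section Frobenius.

Variables (K : closedFieldType) (p : nat) (charK : p \in [pchar K]).
Implicit Types (x y : K) (b : bool) (i j m n u v q r : nat).

Local Notation F := (frob charK).

Lemma frob_is_zmod_morphism j : zmod_morphism (F j).
Proof.
move=> x y; have pn : [pchar K].-nat (p ^ j)%N.
  by rewrite pnatX (eq_pnat _ (pcharf_eq charK)) pnat_id ?(pcharf_prime charK).
by rewrite /frob exprDn_pchar // exprNn_pchar.
Qed.

Lemma frob_is_monoid_morphism j : monoid_morphism (F j).
Proof. by split=> [|x y]; rewrite /frob ?expr1n ?exprMn. Qed.

HB.instance Definition _ j :=
  GRing.isZmodMorphism.Build K K (F j) (frob_is_zmod_morphism j).
HB.instance Definition _ j :=
  GRing.isMonoidMorphism.Build K K (F j) (frob_is_monoid_morphism j).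

Lemma frob0 x : F 0 x = x.
Proof. by rewrite /frob expn0 expr1. Qed.

Lemma frobD i j x : F (i + j) x = F i (F j x).
Proof. by rewrite /frob -exprM -expnD addnC. Qed.

Lemma GF_frobP n x : reflect (F n x = x) (x \in GF p K n).
Proof. exact: eqP. Qed.

Lemma frob_mul n x q : x \in GF p K n -> F (q * n) x = x.
Proof.
by move=> /GF_frobP xF; elim: q => [|q IHq]; rewrite ?frob0 // mulSn frobD IHq.
Qed.

Lemma GF_dvd m n x : (m %| n)%N -> x \in GF p K m -> x \in GF p K n.
Proof. by move=> /dvdnP[q ->] xF; apply/GF_frobP/frob_mul. Qed.

Lemma frob_mod n i x : x \in GF p K n -> F (i %% n) x = F i x.
Proof. by move=> xF; rewrite [in RHS](divn_eq i n) addnC frobD frob_mul. Qed.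

Lemma GF_frob n j x : x \in GF p K n -> F j x \in GF p K n.
Proof. by move=> /GF_frobP xF; apply/GF_frobP; rewrite -frobD addnC frobD xF. Qed.

(** * Signed sums of Frobenius powers *)

(* The common shape of T (b = false) and S (b = true), with m terms. *)
Definition frobsum b u m x : K :=
  \sum_(0 <= i < m) (-1) ^+ (b * i) * F (u * i) x.

Lemma frobsum_is_zmod_morphism b u m : zmod_morphism (frobsum b u m).
Proof.
by move=> x y; rewrite -sumrB; apply: eq_bigr => i _; rewrite raddfB mulrBr.
Qed.

HB.instance Definition _ b u m :=
  GRing.isZmodMorphism.Build K K (frobsum b u m) (frobsum_is_zmod_morphism b u m).

Lemma Tpoly_frobsum u v x : (Tpoly p u v).[x] = frobsum false u (v %/ u) x.
Proof.
rewrite /Tpoly horner_sum; apply: eq_bigr => i _.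
by rewrite hornerXn mul1r.
Qed.

Lemma Spoly_frobsum u v x : (Spoly p u v).[x] = frobsum true u (v %/ u) x.
Proof.
rewrite /Spoly horner_sum; apply: eq_bigr => i _.
by rewrite hornerZ hornerXn mul1n.
Qed.

Lemma frob_frobsum j b u m x : F j (frobsum b u m x) = frobsum b u m (F j x).
Proof.
rewrite raddf_sum /=; apply: eq_bigr => i _.
by rewrite rmorphMsign /= -!frobD addnC.
Qed.

Lemma frobsumC b u m b' u' m' x :
  frobsum b u m (frobsum b' u' m' x) = frobsum b' u' m' (frobsum b u m x).
Proof.
rewrite ![frobsum b' _ _ _]/frobsum raddf_sum; apply: eq_bigr => i _ /=.
by rewrite frob_frobsum raddfMsign.
Qed.

Lemma GF_frobsum n b u m x : x \in GF p K n -> frobsum b u m x \in GF p K n.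
Proof. by move=> /GF_frobP xF; apply/GF_frobP; rewrite frob_frobsum xF. Qed.

Lemma frobsum2 u x : frobsum false u 2 x = x + F u x.
Proof. by rewrite /frobsum big_ltn // big_nat1 !muln0 frob0 !mul1r muln1. Qed.

(** Geometric sum in the operator (-1)^b F^u. With b = 0 it shows that traces are fixed by F^u; with
    b = 1 and m even it factors 1 - F^(u m) through 1 + F^u. *)
Lemma frobsum_telescope b u m x :
  frobsum b u m x - (-1) ^+ b * F u (frobsum b u m x)
    = x - (-1) ^+ (b * m) * F (u * m) x.
Proof.
rewrite raddf_sum big_distrr /= -sumrB.
under eq_bigr => i _ do
  rewrite rmorphMsign mulrA -exprD -mulnS /= -frobD -mulnS -opprB.
by rewrite sumrN telescope_sumr // opprB !muln0 frob0 mul1r.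
Qed.

(** The summands are periodic of period [r], so the sum splits into [q] equal blocks. *)
Lemma frobsum_mul b u q r x : (-1) ^+ (b * r) * F (u * r) x = x ->
  frobsum b u (q * r) x = frobsum b u r x *+ q.
Proof.
move=> per; elim: q => [|q IHq]; first by rewrite mul0n /frobsum big_geq.
rewrite mulSn mulrS -IHq /frobsum (big_cat_nat (n := r)) ?leq_addr //=.
congr (_ + _); rewrite -{1}[r]add0n big_addn addKn; apply: eq_bigr => i _.
by rewrite -[in RHS]per rmorphMsign mulrA -exprD -mulnDr /= -frobD -mulnDr.
Qed.

(** On F_(p^n) the power F^(l i) depends only on l i modulo n = e r. As l/e is coprime to r,
    multiplication by l/e permutes the residues modulo r, so both sums have the same terms. *)
Lemma frobsum_gcd n l x : (0 < n)%N -> (0 < l)%N -> x \in GF p K n ->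
  frobsum false l (n %/ gcdn n l) x = frobsum false (gcdn n l) (n %/ gcdn n l) x.
Proof.
move=> n_gt0 l_gt0 xF; set e := gcdn n l; set r := (n %/ e)%N.
have e_gt0 : (0 < e)%N by rewrite gcdn_gt0 n_gt0.
have r_gt0 : (0 < r)%N by rewrite divn_gt0 // dvdn_leq // dvdn_gcdl.
have Dn : (e * r)%N = n by rewrite mulnC divnK // dvdn_gcdl.
have Dl : (e * (l %/ e))%N = l by rewrite mulnC divnK // dvdn_gcdr.
have co_rl : coprime r (l %/ e).
  by rewrite /coprime -(eqn_pmul2l e_gt0) muln_gcdr Dn Dl muln1.
rewrite /frobsum !big_mkord.
pose h (i : 'I_r) : 'I_r := Ordinal (ltn_pmod (l %/ e * i) r_gt0).
have h_inj : injective h.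
  suff le_inj (i j : 'I_r) : (i <= j)%N -> h i = h j -> i = j.
    by move=> i j; case/orP: (leq_total i j) => [|/le_inj hij /esym /hij]; auto.
  move=> le_ij [] /esym/eqP; rewrite eqn_mod_dvd ?leq_mul // -mulnBr.
  rewrite Gauss_dvdr // => dv; apply/val_inj/eqP; rewrite eqn_leq le_ij /=.
  rewrite -subn_eq0; apply/contraLR: dv; rewrite -lt0n => ji_gt0.
  by rewrite gtnNdvd // (leq_ltn_trans (leq_subr _ _)).
rewrite [RHS](reindex_inj h_inj) /=; apply: eq_bigr => i _.
by rewrite !mul1r muln_modr Dn mulnA Dl frob_mod.
Qed.

Lemma frob_scale s u w : F u w = - w -> F (s * u) w = (-1) ^+ s * w.
Proof.
move=> Fw; elim: s => [|s IHs]; first by rewrite frob0 mul1r.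
by rewrite mulSnr frobD Fw rmorphN /= IHs exprS mulN1r mulNr.
Qed.

Lemma frobsumS b u m x :
  frobsum b u m.+1 x = frobsum b u m x + (-1) ^+ (b * m) * F (u * m) x.
Proof. by rewrite /frobsum big_nat_recr. Qed.

(** Pairs consecutive terms, turning a trace with step [u] into one with step [2 * u]. *)
Lemma frobsum_double u q x :
  frobsum false u q.*2 x = frobsum false (2 * u) q (x + F u x).
Proof.
elim: q => [|q IHq]; first by rewrite /frobsum !big_geq.
rewrite doubleS !frobsumS IHq !mul1r.
rewrite -addrA [F _ (_ + _)]raddfD /= -frobD -mul2n; congr (_ + (F _ x + F _ x)); lia.
Qed.

(** * Elements of relative trace 1 *)

Lemma size_Xpn_sum u m : (0 < u)%N ->
  size (\sum_(0 <= i < m.+1) 'X^(p ^ (u * i)) : {poly K}) = (p ^ (u * m)).+1.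
Proof.
move=> u_gt0; elim: m => [|m IHm]; first by rewrite big_nat1 size_polyXn.
rewrite big_nat_recr //= addrC size_polyDl size_polyXn // IHm ltnS.
by rewrite ltn_exp2l ?(prime_gt1 (pcharf_prime charK)) // ltn_pmul2l.
Qed.

Lemma Tpoly_surj u v : (0 < u)%N -> (0 < v)%N -> (u %| v)%N ->
  exists x, x \in GF p K v /\ (Tpoly p u v).[x] = 1.
Proof.
move=> u_gt0 v_gt0 u_dvd_v; have p_gt1 := prime_gt1 (pcharf_prime charK).
(* T has degree p^(v-u) < p^v, so it has a non-root in F_(p^v). *)
have [s [Us szs sF]] := GF_card charK v_gt0.
have m_gt0 : (0 < v %/ u)%N by rewrite divn_gt0 // dvdn_leq.
have Dv : v = (u * (v %/ u).-1.+1)%N by rewrite (prednK m_gt0) mulnC divnK.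
have szT : size (Tpoly p u v : {poly K}) = (p ^ (u * (v %/ u).-1)).+1.
  by rewrite -(size_Xpn_sum _ u_gt0) (prednK m_gt0).
have [z zs Tz_neq0] : exists2 z, z \in s & (Tpoly p u v).[z] != 0.
  apply/hasP; rewrite -[has _ _]negbK -all_predC; apply/negP => /= sT0.
  have T_neq0 : Tpoly p u v != 0 :> {poly K} by rewrite -size_poly_eq0 szT.
  have rT : all (root (Tpoly p u v)) s.
    by apply/allP => x /(allP sT0) /=; rewrite negbK.
  have := max_poly_roots T_neq0 rT Us.
  by rewrite szT szs ltnS leqNgt ltn_exp2l // {2}Dv ltn_pmul2l // ltnSn.
set t := (Tpoly p u v).[z] in Tz_neq0.
have zF : z \in GF p K v by rewrite -sF.
have tF : t \in GF p K u.
  apply/GF_frobP; have := frobsum_telescope false u (v %/ u) z.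
  rewrite -Tpoly_frobsum !mul1r mulnC divnK // (GF_frobP _ _ zF) subrr.
  by move=> /subr0_eq.
(* T is linear over F_(p^u), which contains [t], so dividing [z] by [t] normalizes the value to
   1. *)
exists (t^-1 * z); split.
  apply/GF_frobP; rewrite rmorphM fmorphV /= (GF_frobP _ _ zF).
  by rewrite (GF_frobP _ _ (GF_dvd u_dvd_v tF)).
have -> : (Tpoly p u v).[t^-1 * z] = t^-1 * t; last by rewrite mulVf.
rewrite Tpoly_frobsum [X in _ = _ * X]Tpoly_frobsum /frobsum big_distrr; apply: eq_bigr => i _ /=.
by rewrite !mul1r rmorphM fmorphV /= [(u * i)%N]mulnC [F _ t]frob_mul.
Qed.

(** * The equation S_l^k(X) = a over F_(p^n) *)

Section Solutions.

Variables (n k l : nat).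
Hypotheses (n_gt0 : (0 < n)%N) (k_gt0 : (0 < k)%N) (l_gt0 : (0 < l)%N).
Hypotheses (l_dvd_k : (l %| k)%N) (kl_even : ~~ odd (k %/ l)).

Local Notation d := (gcdn n k).
Local Notation e := (gcdn n l).
Local Notation L := (lcmn d l).
Local Notation r := (d %/ e)%N.
Local Notation T x := (Tpoly p d n).[x].
Local Notation S x := (Spoly p l k).[x].

Let d_gt0 : (0 < d)%N. Proof. by rewrite gcdn_gt0 n_gt0. Qed.
Let e_gt0 : (0 < e)%N. Proof. by rewrite gcdn_gt0 n_gt0. Qed.

Lemma gcdn_gcd_dvd : gcdn d l = e.
Proof. by rewrite -gcdnA; congr gcdn; apply/gcdn_idPr. Qed.

Lemma lcmn_gcd_dvd : L = (l * r)%N.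
Proof. by rewrite /lcmn gcdn_gcd_dvd mulnC muln_divA // -gcdn_gcd_dvd dvdn_gcdl. Qed.

Lemma divn_dvd_lcm : (k %/ l = k %/ L * r)%N.
Proof.
have L_dvd_k : (L %| k)%N by rewrite dvdn_lcm dvdn_gcdr.
by rewrite -[in LHS](divnK L_dvd_k) [in X in (X %/ l)%N]lcmn_gcd_dvd mulnCA mulKn // -lcmn_gcd_dvd.
Qed.

Lemma Tpoly_gcd x : x \in GF p K n -> T x = frobsum false k (n %/ d) x.
Proof. by move=> xF; rewrite frobsum_gcd // Tpoly_frobsum. Qed.

Lemma GF_Tpoly x : x \in GF p K n -> T x \in GF p K d.
Proof.
move=> xF; apply/GF_frobP; rewrite Tpoly_frobsum.
have := frobsum_telescope false d (n %/ d) x.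
by rewrite !mul1r mulnC divnK ?dvdn_gcdl // (GF_frobP _ _ xF) subrr => /subr0_eq.
Qed.

Lemma frob_Spoly x : S x + F l (S x) = x - F k x.
Proof.
have := frobsum_telescope true l (k %/ l) x.
by rewrite -Spoly_frobsum mul1n expr1 mulN1r opprK -signr_odd (negPf kl_even)
  mul1r mulnC divnK.
Qed.

Lemma Spoly_GF z : z \in GF p K d -> F l (S z) = - S z.
Proof.
move=> zF; have := frob_Spoly z.
by rewrite (GF_frobP _ _ (GF_dvd (dvdn_gcdr n k) zF)) subrr => /addr0_eq.
Qed.

Lemma Tpoly_Spoly x : T (S x) = S (T x).
Proof. by rewrite !Tpoly_frobsum !Spoly_frobsum frobsumC. Qed.

(** Links the solvability criterion of the second case, stated with F^e, to the sign rule
    [Spoly_GF], stated with F^l: on F_(p^d) each of the two is an odd power of the other. *)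
Lemma frob_gcd_opp w : w \in GF p K d -> ~~ odd r ->
  F l w = - w <-> F e w = - w.
Proof.
move=> wF r_even.
(* Bezout: kl * l = kd * d + e, and kl and l/e are odd since r is even. *)
case: (egcdnP d l_gt0) => kl kd; rewrite [gcdn l _]gcdnC gcdn_gcd_dvd => Dkl _.
have Dd : (r * e = d)%N by rewrite divnK // -gcdn_gcd_dvd dvdn_gcdl.
have Dl : (l %/ e * e = l)%N by rewrite divnK // dvdn_gcdr.
have /andP[odd_kl odd_le] : odd kl && odd (l %/ e).
  rewrite -oddM -[(kl * _)%N](mulnK _ e_gt0) -mulnA Dl Dkl -Dd mulnA.
  by rewrite -[X in (_ + X)%N]mul1n -mulnDl mulnK // oddD oddM (negPf r_even) andbF.
split=> [/(frob_scale kl)|/(frob_scale (l %/ e))].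
  by rewrite Dkl addnC frobD frob_mul // -signr_odd odd_kl mulN1r.
by rewrite Dl -signr_odd odd_le mulN1r.
Qed.

Lemma Spoly_GF_eq0 z : p <> 2%N -> z \in GF p K d ->
  odd r \/ ~~ odd r /\ (p %| k %/ L)%N -> S z = 0.
Proof.
move=> p_neq2 zF [r_odd|[r_even p_dvd]].
  have wF : S z \in GF p K d by rewrite Spoly_frobsum GF_frobsum.
  have := frob_scale r (Spoly_GF zF).
  (* Here l r = L is a multiple of d, so F^(l r) fixes [S z]; for r odd this gives S z = - S z. *)
  rewrite mulnC -lcmn_gcd_dvd (GF_frobP _ _ (GF_dvd (dvdn_lcml d l) wF)).
  rewrite -signr_odd r_odd mulN1r => /eqP; rewrite -addr_eq0 -mulr2n.
  rewrite -mulr_natr mulf_eq0 -(dvdn_pcharf charK) => /orP[/eqP//|].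
  by rewrite dvdn_prime2 ?(pcharf_prime charK) // => /eqP.
rewrite Spoly_frobsum divn_dvd_lcm frobsum_mul.
  by apply/eqP; rewrite -mulr_natr mulf_eq0 -(dvdn_pcharf charK) p_dvd orbT.
rewrite mul1n -signr_odd (negPf r_even) mul1r -lcmn_gcd_dvd.
exact/GF_frobP/(GF_dvd (dvdn_lcml d l)).
Qed.

(** The sign (-1)^i in S cancels against F^(l i) w = (-1)^i w. *)
Lemma Spoly_mul_opp w x : F l w = - w ->
  S (w * x) = w * frobsum false l (k %/ l) x.
Proof.
move=> Fw; rewrite Spoly_frobsum /frobsum big_distrr; apply: eq_bigr => i _ /=.
rewrite rmorphM /= [in F _ w]mulnC frob_scale // mul1n mul1r !mulrA -exprD.
by rewrite addnn -mul2n exprM sqrrN !expr1n mul1r.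
Qed.

(** The k/l terms form k/L blocks of length r. Each block is T_e^d(x) = T_(2e)^d(x) +
    F^e(T_(2e)^d(x)) = 2. *)
Lemma frobsum_GF_half x : x \in GF p K d -> ~~ odd r ->
  (Tpoly p (2 * e) d).[x] = 1 -> frobsum false l (k %/ l) x = (2 * k %/ L)%:R.
Proof.
move=> xF r_even Tx.
have L_dvd_k : (L %| k)%N by rewrite dvdn_lcm dvdn_gcdr.
rewrite divn_dvd_lcm frobsum_mul; last first.
  by rewrite mul1r -lcmn_gcd_dvd; apply/GF_frobP/(GF_dvd (dvdn_lcml d l)).
rewrite -muln_divA // natrM mulr_natr; congr (_ *+ _).
rewrite -[e in LHS]gcdn_gcd_dvd frobsum_gcd // gcdn_gcd_dvd.
rewrite -(even_halfK r_even) frobsum_double raddfD /= -frob_frobsum.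
by rewrite -divn2 -divnMA [(e * 2)%N]mulnC -Tpoly_frobsum Tx rmorph1.
Qed.

Lemma Hilbert90_GF delta a : delta \in GF p K n -> a \in GF p K n ->
    T delta = 1 -> T a = 0 ->
  let y := \sum_(0 <= i < (n %/ d).-1) \sum_(i.+1 <= j < n %/ d)
            delta ^+ (p ^ (k * j)) * a ^+ (p ^ (k * i)) in
  y \in GF p K n /\ y - F k y = a.
Proof.
move=> dF aF; rewrite !Tpoly_gcd // => Td Ta y; split.
  apply/GF_frobP; rewrite raddf_sum; apply: eq_bigr => i _.
  rewrite raddf_sum; apply: eq_bigr => j _ /=; rewrite rmorphM /=.
  by rewrite !(GF_frobP _ _ (GF_frob _ _)).
have := additive_hilbert90 (D := fun j => F (k * j) delta) (A := fun i => F (k * i) a)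
  (n := (n %/ d)%N).
rewrite muln0 !frob0 => <- //.
- rewrite /y raddf_sum; congr (_ - _); apply: eq_bigr => i _.
  rewrite raddf_sum; apply: eq_bigr => j _ /=.
  by rewrite rmorphM !mulnS !frobD.
- by rewrite divn_gt0 // dvdn_leq // dvdn_gcdl.
- apply/GF_frobP/(GF_dvd _ dF).
  (* The conjugates of [delta] wrap around after n/d steps, since k (n/d) = n (k/d). *)
  by rewrite -muln_divCA_gcd dvdn_mulr.
- by apply: etrans Td; apply: eq_bigr => i _; rewrite mul1r.
- by apply: etrans Ta; apply: eq_bigr => i _; rewrite mul1r.
Qed.

End Solutions.

End Frobenius.

Theorem theorem5 (p : nat) (K : closedFieldType) (iota : {rmorphism 'F_p -> K})
    (algK : forall x : K, algebraicOver iota x)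
    (p_prime : prime p) (p_neq2 : p <> 2%N)
    (n k l : nat) (n_gt0 : (0 < n)%N) (k_gt0 : (0 < k)%N) (l_gt0 : (0 < l)%N)
    (l_dvd_k : (l %| k)%N) (kl_even : ~~ odd (k %/ l))
    (a : K) (aF : a \in GF p K n) :
  let d := gcdn n k in
  let e := gcdn n l in
  let L := lcmn d l in
  forall delta : K, delta \in GF p K n -> delta <> 0 ->
    (Tpoly p d n).[delta] = 1 ->
  (odd (d %/ e) \/ (~~ odd (d %/ e) /\ (p %| k %/ L)%N) ->
    ((exists x : K, x \in GF p K n /\ (Spoly p l k).[x] = a) <->
       (Tpoly p d n).[a] = 0) /\
    ((Tpoly p d n).[a] = 0 ->
       let x0 := (Tpoly p l (2 * l)).[
         \sum_(0 <= i < (n %/ d).-1) \sum_(i.+1 <= j < n %/ d)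
            delta ^+ (p ^ (k * j)) * a ^+ (p ^ (k * i))] in
       x0 \in GF p K n /\ (Spoly p l k).[x0] = a)) /\
  (~~ odd (d %/ e) /\ ~~ (p %| k %/ L)%N ->
    ((exists x : K, x \in GF p K n /\ (Spoly p l k).[x] = a) <->
       (Tpoly p e (2 * e) \Po Tpoly p d n).[a] = 0) /\
    ((Tpoly p e (2 * e) \Po Tpoly p d n).[a] = 0 ->
     forall delta1 : K, delta1 \in GF p K d -> delta1 <> 0 ->
       (Tpoly p (2 * e) d).[delta1] = 1 ->
       let y0 := \sum_(0 <= i < (n %/ d).-1) \sum_(i.+1 <= j < n %/ d)
            delta ^+ (p ^ (k * j)) *
              (Tpoly p l (2 * l)).[a] ^+ (p ^ (k * i)) in
       let x0 := y0 + iota ((((2 * k) %/ L)%:R : 'F_p)^-1)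
                        * (a - (Spoly p l k).[y0]) * delta1 in
       x0 \in GF p K n /\ (Spoly p l k).[x0] = a)).
Proof.
move=> d e L delta dF _ Tdelta.
have charK : p \in [pchar K] by apply/(rmorph_pchar iota)/pchar_Fp.
have T2 u x : (0 < u)%N -> (Tpoly p u (2 * u)).[x] = x + frob charK u x.
  by move=> u_gt0; rewrite (Tpoly_frobsum charK) mulnK // frobsum2.
have SE := Spoly_frobsum charK.
have d_gt0 : (0 < d)%N by rewrite gcdn_gt0 n_gt0.
have e_gt0 : (0 < e)%N by rewrite gcdn_gt0 n_gt0.
split=> [cond | [r_even p_ndvd]].
  have sol : (Tpoly p d n).[a] = 0 ->
     let x0 := (Tpoly p l (2 * l)).[
         \sum_(0 <= i < (n %/ d).-1) \sum_(i.+1 <= j < n %/ d)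
            delta ^+ (p ^ (k * j)) * a ^+ (p ^ (k * i))] in
       x0 \in GF p K n /\ (Spoly p l k).[x0] = a.
    move=> Ta x0; have [] := Hilbert90_GF charK n_gt0 k_gt0 dF aF Tdelta Ta.
    rewrite /x0; set y := \sum_(0 <= i < _) _ => yF ya.
    rewrite (Tpoly_frobsum charK) GF_frobsum //; split=> //.
    (* S commutes with 1 + F^l, so S x0 = (1 + F^l) S y = y - F^k y = a. *)
    rewrite SE -frobsumC -SE -(Tpoly_frobsum charK) T2 //.
    by rewrite (frob_Spoly charK).
  split=> //; split=> [[x [xF <-]]|/sol xP]; last by eexists; exact: xP.
  rewrite (Tpoly_Spoly charK).
  by apply: Spoly_GF_eq0 cond => //; apply: (GF_Tpoly charK k xF).
have wP x : x \in GF p K n -> (Tpoly p e (2 * e) \Po Tpoly p d n).[x] = 0 <->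
    frob charK l (Tpoly p d n).[x] = - (Tpoly p d n).[x].
  move=> xF; rewrite horner_comp T2 //.
  rewrite (frob_gcd_opp charK n_gt0 l_gt0 l_dvd_k (GF_Tpoly charK k xF) r_even).
  by split=> [/addr0_eq|->]; rewrite ?subrr.
have sol : (Tpoly p e (2 * e) \Po Tpoly p d n).[a] = 0 ->
    let y0 := \sum_(0 <= i < (n %/ d).-1) \sum_(i.+1 <= j < n %/ d)
       delta ^+ (p ^ (k * j)) * (Tpoly p l (2 * l)).[a] ^+ (p ^ (k * i)) in
    y0 \in GF p K n /\ frob charK l (a - (Spoly p l k).[y0]) = - (a - (Spoly p l k).[y0]).
  move=> /(wP _ aF) Fw y0.
  have bF : (Tpoly p l (2 * l)).[a] \in GF p K n.
    by rewrite (Tpoly_frobsum charK) GF_frobsum.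
  have Tb : (Tpoly p d n).[(Tpoly p l (2 * l)).[a]] = 0.
    rewrite !(Tpoly_frobsum charK) frobsumC mulnK // frobsum2.
    by rewrite -(Tpoly_frobsum charK) Fw subrr.
  have [] := Hilbert90_GF charK n_gt0 k_gt0 dF bF Tdelta Tb.
  (* Applying 1 + F^l to a - S y0 gives (1 + F^l) a - (y0 - F^k y0), which vanishes by the choice of
     [y0]. *)
  rewrite -/y0 => yF yb; split=> //; apply/esym/addr0_eq.
  rewrite raddfB addrACA -opprD (frob_Spoly charK) //.
  by rewrite yb T2 // subrr.
pose c : K := iota (((2 * k) %/ L)%:R : 'F_p)^-1.
have cE : c = (((2 * k) %/ L)%:R)^-1 by rewrite /c fmorphV rmorph_nat.
have p_ndvd2 : ~~ (p %| 2 * k %/ L)%N.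
  rewrite -muln_divA; last by rewrite dvdn_lcm dvdn_gcdr.
  by rewrite Euclid_dvdM // negb_or p_ndvd andbT dvdn_prime2 //; apply/eqP.
have part (Ta : (Tpoly p e (2 * e) \Po Tpoly p d n).[a] = 0) delta1 :
    delta1 \in GF p K d -> (Tpoly p (2 * e) d).[delta1] = 1 ->
    let y0 := \sum_(0 <= i < (n %/ d).-1) \sum_(i.+1 <= j < n %/ d)
       delta ^+ (p ^ (k * j)) * (Tpoly p l (2 * l)).[a] ^+ (p ^ (k * i)) in
    let x0 := y0 + c * (a - (Spoly p l k).[y0]) * delta1 in
    x0 \in GF p K n /\ (Spoly p l k).[x0] = a.
  move=> d1F Td1 y0 x0; have [yF] := sol Ta.
  set u := a - (Spoly p l k).[y0] => Fu.
  have uF : frob charK n u = u.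
    by rewrite /u raddfB /= SE frob_frobsum !(GF_frobP charK _ _ _).
  have x0E : x0 = y0 + u * c * delta1 by rewrite [u * c]mulrC.
  (* [c] lies in the prime field, so scaling [u] by it keeps the sign rule under F^l. *)
  have cF j : frob charK j c = c by rewrite cE fmorphV rmorph_nat.
  split.
    apply/(GF_frobP charK).
    rewrite x0E raddfD /= !rmorphM /= uF cF !(GF_frobP charK _ _ _) //.
    exact/(GF_dvd charK _ d1F)/dvdn_gcdl.
  have Fuc : frob charK l (u * c) = - (u * c) by rewrite rmorphM /= Fu cF mulNr.
  rewrite x0E SE raddfD /= -!SE (Spoly_mul_opp k delta1 Fuc).
  rewrite (frobsum_GF_half charK n_gt0 l_gt0 l_dvd_k d1F r_even Td1) cE mulfVK.
    by rewrite addrC subrK.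
  by rewrite -(dvdn_pcharf charK).
split=> [|Ta delta1 d1F _]; last exact: part.
split=> [[x [xF <-]]|Ta].
  apply/wP; first by rewrite SE GF_frobsum.
  by rewrite (Tpoly_Spoly charK) (Spoly_GF charK l_dvd_k kl_even (GF_Tpoly charK k xF)).
(* Solvability does not presuppose a [delta1], so one is produced; 2e divides d because d/e is
   even. *)
have [|||delta1 [d1F Td1]] := Tpoly_surj charK (u := 2 * e) (v := d).
- by rewrite muln_gt0.
- by [].
- have e_dvd_d : (e %| d)%N by rewrite /e -(gcdn_gcd_dvd n l_dvd_k) dvdn_gcdl.
  by rewrite -(divnK e_dvd_d) dvdn_pmul2r // dvdn2.
by eexists; apply: (part Ta _ d1F Td1).
Qed.
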